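(* Let $\mathcal{C}$ be a category with finite sums (finite coproducts) and kernel pairs. If a functor $F:\mathcal{C}\to\mathcal{C}$ weakly preserves kernel pairs, then $F$ weakly preserves pullbacks of retractions; that is, whenever $(P,p_1,p_2)$ is a pullback in $\mathcal{C}$ of two retractions $f_1:A_1\to C$ and $f_2:A_2\to C$, then $(F(P),Fp_1,Fp_2)$ is a weak pullback of $Ff_1$ and $Ff_2$.
   Context: A retraction is a right-invertible morphism, i.e. a morphism $f:A\to C$ for which there is $g:C\to A$ with $f\circ g=\mathrm{id}_C$. A weak pullback of $f_1:A_1\to C$ and $f_2:A_2\to C$ is a triple $(P,p_1,p_2)$ with $p_i:P\to A_i$, $f_1\circ p_1=f_2\circ p_2$, such that for every $(Q,q_1,q_2)$ with $q_i:Q\to A_i$ and $f_1\circ q_1=f_2\circ q_2$ there exists a (not necessarily unique) $q:Q\to P$ with $p_i\circ q=q_i$. A kernel pair is a pullback of a morphism with itself. A functor weakly preserves kernel pairs if it transforms each kernel pair diagram into a weak pullback diagram. *)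

(* Defs.v *)
From mathcomp Require Import all_boot.

Set Implicit Arguments.
Unset Strict Implicit.
Unset Printing Implicit Defensive.

Declare Scope cat_scope.
Delimit Scope cat_scope with cat.

(* [obj] and [hom] live in two unrelated universes, so large categories (sets,
   topological spaces, coalgebras) are covered as well as small ones. *)
Record category := Category {
  obj :> Type;
  hom : obj -> obj -> Type;
  idm : forall A, hom A A;
  compm : forall A B D, hom B D -> hom A B -> hom A D;
  comp1m : forall A B (f : hom A B), compm (idm B) f = f;
  compm1 : forall A B (f : hom A B), compm f (idm A) = f;
  compmA : forall A B D E (h : hom D E) (g : hom B D) (f : hom A B),
    compm h (compm g f) = compm (compm h g) f }.

Arguments hom {c} A B.
Arguments idm {c} A.
Arguments compm {c A B D} g f.

Notation "g ∘ f" := (compm g f) (at level 40, left associativity) : cat_scope.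
Local Open Scope cat_scope.

Record functor (C D : category) := Functor {
  fobj :> C -> D;
  fmap : forall A B : C, hom A B -> hom (fobj A) (fobj B);
  fmap1 : forall A : C, fmap (idm A) = idm (fobj A);
  fmapM : forall (A B E : C) (g : hom B E) (f : hom A B),
    fmap (g ∘ f) = fmap g ∘ fmap f }.

Arguments fmap {C D} F {A B} f : rename.

Definition is_retraction (C : category) (A B : C) (f : hom A B) : Prop :=
  exists g : hom B A, f ∘ g = idm B.

Definition is_pullback (C : category) (A1 A2 B P : C)
    (f1 : hom A1 B) (f2 : hom A2 B) (p1 : hom P A1) (p2 : hom P A2) : Prop :=
  f1 ∘ p1 = f2 ∘ p2 /\
  forall (Q : C) (q1 : hom Q A1) (q2 : hom Q A2), f1 ∘ q1 = f2 ∘ q2 ->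
    exists! q : hom Q P, p1 ∘ q = q1 /\ p2 ∘ q = q2.

Definition is_weak_pullback (C : category) (A1 A2 B P : C)
    (f1 : hom A1 B) (f2 : hom A2 B) (p1 : hom P A1) (p2 : hom P A2) : Prop :=
  f1 ∘ p1 = f2 ∘ p2 /\
  forall (Q : C) (q1 : hom Q A1) (q2 : hom Q A2), f1 ∘ q1 = f2 ∘ q2 ->
    exists q : hom Q P, p1 ∘ q = q1 /\ p2 ∘ q = q2.

Definition is_kernel_pair (C : category) (A B K : C)
    (f : hom A B) (k1 k2 : hom K A) : Prop :=
  is_pullback f f k1 k2.

Definition has_kernel_pairs (C : category) : Prop :=
  forall (A B : C) (f : hom A B),
  exists (K : C) (k1 k2 : hom K A), is_kernel_pair f k1 k2.

Definition is_coproduct (C : category) (I : Type) (A : I -> C) (S : C)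
    (e : forall i, hom (A i) S) : Prop :=
  forall (X : C) (g : forall i, hom (A i) X),
  exists! h : hom S X, forall i, h ∘ e i = g i.

(* The index type may be empty, so an initial object is included. *)
Definition has_finite_coproducts (C : category) : Prop :=
  forall (I : finType) (A : I -> C),
  exists (S : C) (e : forall i, hom (A i) S), is_coproduct e.

Definition weakly_preserves_kernel_pairs (C D : category) (F : functor C D) :
    Prop :=
  forall (A B K : C) (f : hom A B) (k1 k2 : hom K A),
  is_kernel_pair f k1 k2 ->
  is_weak_pullback (fmap F f) (fmap F f) (fmap F k1) (fmap F k2).

Definition weakly_preserves_pullbacks_of_retractions (C D : category)
    (F : functor C D) : Prop :=
  forall (A1 A2 B P : C) (f1 : hom A1 B) (f2 : hom A2 B)
    (p1 : hom P A1) (p2 : hom P A2),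
  is_retraction f1 -> is_retraction f2 ->
  is_pullback f1 f2 p1 p2 ->
  is_weak_pullback (fmap F f1) (fmap F f2) (fmap F p1) (fmap F p2).

(* Main.v *)
From mathcomp Require Import all_boot.
Require Import Defs.

(** Let [g1], [g2] be sections of [f1], [f2].  On the sum [S] of [A1] and [A2],
    the copairings [r1 = [id, g1 f2]] and [r2 = [g2 f1, id]] satisfy
    [f1 r1 = [f1, f2] = f2 r2].  Hence the kernel pair [(K, k1, k2)] of
    [[f1, f2]] maps to the pullback [P] by some [m] with [p_i m = r_i k_i].
    If [F f1 q1 = F f2 q2], then [F e1 q1] and [F e2 q2] ([e_i] the injections)
    are equalized by [F [f1, f2]], so they factor through [F K] by some [q], and
    [F m q] is the required mediating morphism because [r_i e_i = id]. *)

Local Open Scope cat_scope.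

(** Taking [bool] as index type turns an indexed sum into a pair of injections. *)
Lemma binary_coproduct (C : category) (A1 A2 : C) :
  has_finite_coproducts C ->
  exists (S : C) (e1 : hom A1 S) (e2 : hom A2 S),
    forall (X : C) (g1 : hom A1 X) (g2 : hom A2 X),
    exists! h : hom S X, h ∘ e1 = g1 /\ h ∘ e2 = g2.
Proof.
move=> hsum; have [S [e He]] := hsum bool (fun b => if b then A1 else A2).
exists S, (e true), (e false) => X g1 g2.
have [h [hE huniq]] :=
  He X (fun b => if b return hom (if b then A1 else A2) X then g1 else g2).
exists h; split; first by split; [exact: (hE true) | exact: (hE false)].
by move=> h' [h'1 h'2]; apply: huniq => -[].
Qed.

Theorem theorem4 (C : category)
  (hsum : has_finite_coproducts C) (hker : has_kernel_pairs C)
  (F : functor C C) (hF : weakly_preserves_kernel_pairs F) :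
  weakly_preserves_pullbacks_of_retractions F.
Proof.
move=> A1 A2 B P f1 f2 p1 p2 [g1 f1g1] [g2 f2g2] [fp P_univ].
split=> [|Q q1 q2 fq]; first by rewrite -!fmapM fp.
have [S [e1 [e2 S_univ]]] := binary_coproduct C A1 A2 hsum.
have [r1 [[r1e1 r1e2] _]] := S_univ _ (idm A1) (g1 ∘ f2).
have [r2 [[r2e1 r2e2] _]] := S_univ _ (g2 ∘ f1) (idm A2).
have f1r1 : f1 ∘ r1 = f2 ∘ r2.
  (* Both sides restrict to [f1] along [e1] and to [f2] along [e2], because the sections cancel;
     hence both equal the copairing [h]. *)
  have [h [_ huniq]] := S_univ _ f1 f2.
  rewrite -(huniq (f1 ∘ r1)); first apply: huniq.
    by rewrite -!compmA r2e1 r2e2 compmA f2g2 comp1m compm1.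
  by rewrite -!compmA r1e1 r1e2 compmA f1g1 comp1m compm1.
have [K [k1 [k2 Kker]]] := hker _ _ (f1 ∘ r1).
have [fk _] := Kker.
have [m [[p1m p2m] _]] : exists! m, p1 ∘ m = r1 ∘ k1 /\ p2 ∘ m = r2 ∘ k2.
  by apply: P_univ; rewrite !compmA fk f1r1.
have [_ FK_univ] := hF _ _ _ _ _ _ Kker.
have [q [k1q k2q]] : exists q, fmap F k1 ∘ q = fmap F e1 ∘ q1 /\
                               fmap F k2 ∘ q = fmap F e2 ∘ q2.
  (* Only the right-hand side passes to [f2 ∘ r2], so that [r1 ∘ e1] and [r2 ∘ e2] both cancel and
     [fq] remains. *)
  apply: FK_univ; rewrite !compmA -!fmapM {2}f1r1.
  by rewrite -!compmA r1e1 r2e2 !compm1.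
exists (fmap F m ∘ q); rewrite !compmA -!fmapM p1m p2m !fmapM -!compmA k1q k2q.
by rewrite !compmA -!fmapM r1e1 r2e2 !fmap1 !comp1m.
Qed.
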